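(* Let $X$ be a $3$-generated $C_2$-axet (generated by three distinct axes) which has exactly two orbits under its Miyamoto group, namely $\{a\}$ and $X-\{a\}$. Then $X$ is isomorphic (as an axet) to either (1) $X_1(1+n)$, where $n\ge 3$ is finite and odd, or (2) $X_2(1+n)$, where $n=2k$ and $k$ is odd.
   Context: Actions are right actions. For a group $S$, an $S$-axet $(G,X,\tau)$ consists of a group $G$, a $G$-set $X$ and a map $\tau\colon X\times S\to G$, written $\tau_x(s)$, such that for all $x\in X$, $s,s'\in S$, $g\in G$: $\tau_x(s)\in G_x$; $\tau_x(ss')=\tau_x(s)\tau_x(s')$; and $\tau_{xg}(s)=g^{-1}\tau_x(s)g$. Elements of $X$ are called axes. If $S=C_2$ with generator $s$, write $\tau_x=\tau_x(s)$. The Miyamoto group is $\mathrm{Miy}(X)=\langle \tau_x(s): x\in X,s\in S\rangle\le G$. A subset $Y\subseteq X$ is closed if it is invariant under $\tau_y(s)$ for all $y\in Y$, $s\in S$; $\langle Y\rangle$ is the smallest closed subset containing $Y$, and $Y$ generates $X$ if $\langle Y\rangle=X$. A morphism of $S$-axets $(G,X,\tau)\to(G',X',\tau')$ is a map $\psi\colon X\to X'$ with $\psi(y\tau_x(s))=\psi(y)\tau'_{\psi(x)}(s)$ for all $x,y\in X$, $s\in S$; an isomorphism is a bijective morphism. $X(n)$, $n$ finite: the set of vertices of the regular $n$-gon, identified with $\mathbb Z/n\mathbb Z$, with $G=D_{2n}$ (order $2n$) and $\tau_i$ the reflection $j\mapsto 2i-j$. $X_1(1+n)=\{a\}\cup X(n)$,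 where $a\notin X(n)$, $G=D_{2n}$ fixes $a$ and acts on $X(n)$ as before, $\tau_i$ ($i\in X(n)$) is as in $X(n)$ and $\tau_a=1$. $X_2(1+n)=\{a\}\cup X(n)$ for $n=2k$ even: the same, except that $\tau_a\in D_{2n}$ is the rotation of the $n$-gon through $180^\circ$, i.e. $\tau_a\colon j\mapsto j+k$. *)

(* Defs.v *)
From HB Require Import structures.
From mathcomp Require Import all_boot all_order all_fingroup all_algebra.
From mathcomp Require Import boolp classical_sets.

Set Implicit Arguments.
Unset Strict Implicit.
Unset Printing Implicit Defensive.

Local Open Scope classical_set_scope.
Local Open Scope group_scope.

(* Actions are right actions: [axact x g] is x g. Neither the group nor the set
   of axes is assumed finite. *)
Record axet (S : groupType) := Axet {
  axes :> Type;
  axet_group : groupType;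
  axact : axes -> axet_group -> axes;
  axtau : axes -> S -> axet_group;
  axact1 : forall x, axact x 1 = x;
  axactM : forall x g h, axact x (g * h) = axact (axact x g) h;
  axtau_stab : forall x s, axact x (axtau x s) = x;
  axtauM : forall x s s', axtau x (s * s') = axtau x s * axtau x s';
  axtauJ : forall x g s, axtau (axact x g) s = g^-1 * axtau x s * g
}.

Definition subgroup_set (G : groupType) (H : set G) : Prop :=
  [/\ H 1, forall g h, H g -> H h -> H (g * h) & forall g, H g -> H g^-1].

Section AxetTheory.
Variables (S : groupType) (X : axet S).

Definition miy : set (axet_group X) :=
  smallest (@subgroup_set _) [set g | exists x s, g = @axtau S X x s].

Definition miy_orbit (x : X) : set X := [set axact x g | g in miy].

Definition miy_orbits : set (set X) := [set miy_orbit x | x in [set: X]].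

Definition axet_closed (Y : set X) : Prop :=
  forall y s z, Y y -> Y z -> Y (axact z (axtau y s)).

Definition axet_span (Y : set X) : set X := smallest axet_closed Y.

Definition three_generated : Prop :=
  exists x y z : X,
    [/\ x <> y, x <> z, y <> z & axet_span [set x; y; z] = [set: X]].

End AxetTheory.

Arguments miy {S} X _.
Arguments miy_orbits {S} X _.

Definition axet_morphism (S : groupType) (X X' : axet S) (psi : X -> X') :=
  forall (x y : X) (s : S),
    psi (axact y (axtau x s)) = axact (psi y) (axtau (psi x) s).

Definition axet_iso (S : groupType) (X X' : axet S) : Prop :=
  exists psi : X -> X', axet_morphism psi /\ bijective psi.

(* The group C_2 is 'Z_2, whose group law is addition and whose generator s is
   1%R. A C_2-axet is determined by the elements t x = axtau x s of order
   dividing 2, as axtau x i = (t x) ^+ i for i = 0, 1. *)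
Section C2Axet.
Variables (T : Type) (G : groupType) (to : T -> G -> T) (t : T -> G).
Hypothesis to1 : forall x, to x 1 = x.
Hypothesis toM : forall x g h, to x (g * h) = to (to x g) h.
Hypothesis t_stab : forall x, to x (t x) = x.
Hypothesis t_sq : forall x, t x * t x = 1.
Hypothesis tJ : forall x g, t (to x g) = g^-1 * t x * g.

Let tauC2 (x : T) (i : 'Z_2) : G := t x ^+ i.

Fact tauC2_stab x i : to x (tauC2 x i) = x.
Proof. by rewrite /tauC2; case: i => [[|[|i]]] //= _; rewrite ?to1 ?t_stab. Qed.

Fact tauC2M x i j : tauC2 x (i * j) = tauC2 x i * tauC2 x j.
Proof.
rewrite /tauC2; case: i j => [[|[|i]]] // ? [[|[|j]]] //= ?;
by rewrite ?expg0 ?expg1 ?mul1g ?mulg1 ?t_sq.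
Qed.

Fact tauC2J x g i : tauC2 (to x g) i = g^-1 * tauC2 x i * g.
Proof.
by rewrite /tauC2; case: i => [[|[|i]]] //= _; rewrite ?tJ // mulg1 mulVg.
Qed.

Definition C2_axet : axet 'Z_2 := Axet to1 toM tauC2_stab tauC2M tauC2J.

End C2Axet.

(* Z/nZ for n >= 1; the notation also gives the trivial group for n = 0, a
   value excluded wherever it matters. *)
Notation Zmod n := 'I_n.-1.+1.

(* The dihedral group D_{2n} of order 2n: the pair (e, r) stands for the
   symmetry j |-> r - j if e is true and j |-> r + j if e is false, multiplied
   in the order of right actions. Unlike its image in the permutations of the
   vertices, it has order 2n also when n = 1, 2. *)
Definition dihedral (n : nat) : Type := (bool * Zmod n)%type.
HB.instance Definition _ n := Finite.on (dihedral n).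

Section Dihedral.
Variable n : nat.

Definition dih_sign (e : bool) (j : Zmod n) : Zmod n :=
  if e then (- j)%R else j.

Definition dih_mul (g h : dihedral n) : dihedral n :=
  (g.1 (+) h.1, (dih_sign h.1 g.2 + h.2)%R).

Definition dih_one : dihedral n := (false, 0%R).

Definition dih_inv (g : dihedral n) : dihedral n :=
  (g.1, dih_sign (~~ g.1) g.2).

Fact dih_mulA : associative dih_mul.
Proof.
case=> [e r] [f s] [g t]; rewrite /dih_mul /= addbA; congr pair.
by case: f; case: g; rewrite /= ?GRing.opprD ?GRing.opprK GRing.addrA.
Qed.

Fact dih_mul1 : left_id dih_one dih_mul.
Proof.
by case=> [e r]; rewrite /dih_mul; case: e; rewrite /= ?GRing.oppr0 GRing.add0r.
Qed.

Fact dih_mulV : left_inverse dih_one dih_inv dih_mul.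
Proof. by case=> [[] r]; rewrite /dih_mul /= GRing.addNr. Qed.

HB.instance Definition _ :=
  Finite_isGroup.Build (dihedral n) dih_mulA dih_mul1 dih_mulV.

Definition dih_act (j : Zmod n) (g : dihedral n) : Zmod n :=
  (dih_sign g.1 j + g.2)%R.

Definition reflection (i : Zmod n) : dihedral n := (true, (i + i)%R).

Definition rotation (r : Zmod n) : dihedral n := (false, r).

(* The vertices are [Some j] and the additional fixed point a is [None]. *)
Definition dih_act_fix (x : option (Zmod n)) (g : dihedral n) :=
  omap (fun j => dih_act j g) x.

(* The value of axtau at the generator of C_2, z being its value at a. *)
Definition tau_fix (z : dihedral n) (x : option (Zmod n)) : dihedral n :=
  if x is Some i then reflection i else z.

Fact dih_act_fix1 x : dih_act_fix x 1 = x.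
Proof. by case: x => //= j; rewrite /dih_act /= GRing.addr0. Qed.

Fact dih_act_fixM x g h :
  dih_act_fix x (g * h) = dih_act_fix (dih_act_fix x g) h.
Proof.
case: x => //= j; congr Some; case: g h => [e r] [f s]; rewrite /dih_act /=.
by case: e; case: f; rewrite /= ?GRing.opprD ?GRing.opprK GRing.addrA.
Qed.

Fact tau_fix_stab z x : dih_act_fix x (tau_fix z x) = x.
Proof. by case: x => //= j; rewrite /dih_act /= GRing.addKr. Qed.

Fact tau_fix_sq z : z * z = 1 -> forall x, tau_fix z x * tau_fix z x = 1.
Proof. by move=> z2 [j|] //=; congr pair; rewrite /= GRing.addNr. Qed.

Fact tau_fixJ z : (forall g, commute z g) ->
  forall x g, tau_fix z (dih_act_fix x g) = g^-1 * tau_fix z x * g.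
Proof.
move=> zC [j|] g /=; last by rewrite -mulgA zC mulKg.
have D (i r : Zmod n) : (i + r + (i + r) = r + (i + i) + r)%R.
  by rewrite GRing.addrACA [RHS]GRing.addrC [RHS]GRing.addrA GRing.addrC.
case: g => [[] r]; congr pair; rewrite /dih_act /= D ?GRing.opprK //.
by rewrite !GRing.opprD GRing.opprK.
Qed.

Definition fix_axet (z : dihedral n) (z2 : z * z = 1)
    (zC : forall g, commute z g) : axet 'Z_2 :=
  C2_axet dih_act_fix1 dih_act_fixM (tau_fix_stab z) (tau_fix_sq z2)
    (tau_fixJ zC).

End Dihedral.

Definition X1 (n : nat) : axet 'Z_2 :=
  fix_axet (mulg1 (1 : dihedral n)) (fun g => commute_sym (commute1 g)).

Definition half_turn (k : nat) : dihedral k.*2 := rotation (inZp k).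

Fact half_turn_sq k : half_turn k * half_turn k = 1.
Proof.
congr pair; apply: val_inj => /=.
by case: k => // k; rewrite modnDm addnn /= modnn.
Qed.

Fact half_turnC k g : commute (half_turn k) g.
Proof.
have kN : (half_turn k).2 = (- (half_turn k).2)%R.
  apply: (@GRing.addrI _ (half_turn k).2); rewrite GRing.subrr.
  exact: (congr1 snd (half_turn_sq k)).
case: g => [[] r]; congr pair => /=; last exact: GRing.addrC.
by rewrite GRing.addrC; congr (_ + _)%R; exact: (esym kN).
Qed.

(* X_2(1+n) is indexed here by k = n/2, whereas X_1(1+n) is [X1 n]. *)
Definition X2 (k : nat) : axet 'Z_2 :=
  fix_axet (half_turn_sq k) (@half_turnC k).

(* Main.v *)
Require Import Defs.
From mathcomp Require Import all_boot all_order all_fingroup all_algebra.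
From mathcomp Require Import boolp classical_sets.
Local Open Scope classical_set_scope.

(** The fixed axis a must be one of the three generators: its complement is
    already closed ([fixed_axis_generator]). Let x and y be the other two.
    As a is fixed by every tau_v, the element tau_a, whose square is 1,
    commutes with every tau_v, so with rho = tau_x tau_y the group generated
    by tau_a, tau_x and tau_y, which is the Miyamoto group, consists of the
    elements tau_x^d rho^i tau_a^e with i an integer. As tau_x fixes x,
    every axis other than a is of the form x rho^i tau_a^e ([translatesE]).

    In particular y = x h with h = rho^i tau_a^e, so that tau_y = tau_x^h =
    tau_x rho^(2i), while tau_y = tau_x rho by definition. Hence rho^(2i-1)
    = 1, so that rho^c = 1 for some odd c > 0 ([rho_odd_order]); this is
    where finiteness comes from. Therefore rho and tau_a generate a cyclic
    group, with generator sigma = rho tau_a: tau_a = sigma^c and rho =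
    sigma^(c+1). The axes other than a form a single cycle x sigma^i, say of
    length n, and n divides 2c. As tau_x inverts sigma, this cycle is the
    n-gon ([recognize_fix_axet]), on which tau_a acts as sigma^c. If n is
    odd then n divides c, so tau_a acts trivially and the axet is X_1(1+n).
    If n = 2k then k divides c, so k is odd and c is congruent to k modulo
    n; hence tau_a acts as the half turn and the axet is X_2(1+n). *)

Local Open Scope group_scope.

(** * Closed subsets and the Miyamoto group *)

Section MiyamotoGroup.
Variables (S : groupType) (X : axet S).

Lemma axtau_miy (v : X) s : miy X (axtau v s).
Proof. by move=> K [_]; apply; exists v, s. Qed.

Lemma miy1 : miy X 1.
Proof. by move=> K [[]]. Qed.

(** The axes v with tau_v valued in K form a closed subset, because tau at
    z tau_v(s) is a conjugate of tau_z by tau_v(s). *)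
Lemma miy_sub_subgroup (Y : set X) (K : set (axet_group X)) :
  axet_span Y = setT -> subgroup_set K ->
  (forall y s, Y y -> K (axtau y s)) -> miy X `<=` K.
Proof.
move=> spanY gK YK.
suff K_tau v s : K (axtau v s).
  by apply: smallest_sub => // _ [v [s ->]]; apply: K_tau.
have: axet_span Y v by rewrite spanY.
move=> /(_ [set w | forall s, K (axtau w s)]); apply; split; last first.
  by move=> y Yy s0; apply: YK.
case: gK => [_ KM KV] y s1 z Ky Kz s2; rewrite axtauJ.
by apply/KM => //; apply/KM => //; apply: KV.
Qed.

(** The complement of a point fixed by every tau_y(s) is closed, as these act
    by permutations. *)
Lemma fixed_axis_generator (Y : set X) (a : X) :
  axet_span Y = setT -> (forall y s, axact a (axtau y s) = a) -> Y a.
Proof.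
move=> spanY fix_a; apply: contrapT => Ya.
have: axet_span Y a by rewrite spanY.
move=> /(_ (~` [set a])) []; last by [].
split=> [y s z _ za E|y Yy ya]; last by apply: Ya; rewrite -ya.
apply: za; rewrite /= -[z]axact1 -(mulgV (axtau y s)) axactM E.
by rewrite -[in LHS](fix_a y s) -axactM mulgV axact1.
Qed.

Section TwoOrbits.
Variable a : X.
Hypothesis orbitsE : miy_orbits X = [set [set a]; ~` [set a]].

Lemma two_orbits_fixed g : miy X g -> axact a g = a.
Proof.
have: miy_orbits X [set a] by rewrite orbitsE; left.
case=> b _ ob; have ba : b = a.
  suff: miy_orbit b b by rewrite ob.
  by exists 1; [exact: miy1|rewrite axact1].
move=> Mg; have: miy_orbit b (axact a g) by exists g; rewrite ?ba.
by rewrite ob.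
Qed.

Lemma two_orbits_transitive v w :
  v <> a -> w <> a -> exists2 g, miy X g & w = axact v g.
Proof.
move=> va wa; have: miy_orbits X (miy_orbit v) by exists v.
have vv : miy_orbit v v by exists 1; [exact: miy1|rewrite axact1].
rewrite orbitsE => -[] ov; rewrite ov in vv; first by case: va.
have: miy_orbit v w by rewrite ov.
by case=> g Mg <-; exists g.
Qed.

End TwoOrbits.
End MiyamotoGroup.

(** * Axets for the group with two elements *)

Section C2.
Variable X : axet 'Z_2.

Definition tau (v : X) : axet_group X := axtau v (1%R : 'Z_2).

Lemma axtau0 (v : X) : axtau v (0%R : 'Z_2) = 1.
Proof.
apply: (@mulgI _ (axtau v (0%R : 'Z_2))); rewrite mulg1 -axtauM.
by congr axtau; apply: val_inj.
Qed.

Lemma Z2_cases (s : 'Z_2) : s = 0%R \/ s = 1%R.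
Proof. by case: s => [[|[|s]] Hs] //; [left|right]; apply: val_inj. Qed.

Lemma tau_sq v : tau v * tau v = 1.
Proof. by rewrite -axtauM -(axtau0 v); congr axtau; apply: val_inj. Qed.

Lemma tauV v : (tau v)^-1 = tau v.
Proof. by apply: (@mulgI _ (tau v)); rewrite mulgV tau_sq. Qed.

Lemma tau_stab v : axact v (tau v) = v.
Proof. exact: axtau_stab. Qed.

Lemma tauJ v g : tau (axact v g) = tau v ^ g.
Proof. by rewrite /tau axtauJ conjgE mulgA. Qed.

End C2.

Arguments tau {X} v.

(** * Orbits of cyclic groups *)

Section CyclicOrbit.
Variables (S : groupType) (X : axet S).

Lemma axact_inj (g : axet_group X) : injective (fun v : X => axact v g).
Proof.
move=> v w /(congr1 (fun u => axact u g^-1)).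
by rewrite -!axactM mulgV !axact1.
Qed.

(** The orbit of a point under a cyclic group is a cycle whose length is the
    least positive exponent that fixes the point. *)
Lemma axact_period (x : X) (s : axet_group X) m : (0 < m)%N ->
  axact x (s ^+ m) = x ->
  exists2 n, (0 < n)%N &
    forall i j, axact x (s ^+ i) = axact x (s ^+ j) <-> i = j %[mod n].
Proof.
move=> m0 xm.
pose P n := (0 < n)%N && `[< axact x (s ^+ n) = x >].
have exP : exists n, P n by exists m; rewrite /P m0; apply/asboolP.
case: (ex_minnP exP) => n /andP[n0 /asboolP xn] nmin; exists n => //.
have red i : axact x (s ^+ i) = axact x (s ^+ (i %% n)).
  rewrite {1}(divn_eq i n) expgnDr mulnC expgnA axactM; congr axact.
  by elim: (i %/ n)%N => [|q IH]; rewrite ?axact1 // expgS axactM xn.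
have inj i j : (i <= j < n)%N -> axact x (s ^+ i) = axact x (s ^+ j) -> i = j.
  case/andP=> ij jn /esym; rewrite -{1}(subnK ij) expgnDr axactM.
  move/axact_inj=> xij.
  apply/eqP; rewrite eqn_leq ij /= leqNgt -subn_gt0; apply/negP => ij0.
  have: (n <= j - i)%N by apply: nmin; rewrite /P ij0; apply/asboolP.
  by rewrite leqNgt (leq_ltn_trans (leq_subr _ _) jn).
move=> i j; rewrite red [in X in _ = X]red; split=> [E|-> //].
have [ij|/ltnW ij] := leqP (i %% n) (j %% n).
  by apply: inj E; rewrite ij ltn_mod.
by apply/esym; apply: inj (esym E); rewrite ij ltn_mod.
Qed.

End CyclicOrbit.

(** * Recognizing the axets of a polygon with a fixed axis *)

Lemma Zmod_reflection n (i j : Zmod n) : (0 < n)%N ->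
  dih_act j (reflection i) + j = i + i %[mod n].
Proof.
case: n i j => // n i j _.
apply: (congr1 val (_ : (- j + (i + i) + j = i + i)%R)).
by rewrite GRing.addrAC GRing.addNr GRing.add0r.
Qed.

Lemma Zmod_rotation n (r j : Zmod n) : (0 < n)%N ->
  dih_act j (rotation r) = r + j %[mod n].
Proof. by case: n r j => // n r j _; rewrite /= modn_mod addnC. Qed.

Section Recognition.
Variables (X : axet 'Z_2) (a x : X) (s : axet_group X) (n : nat).
Hypothesis fix_a : forall v, axact a (tau v) = a.
Hypothesis xa : x <> a.
Hypothesis fix_as : axact a s = a.
Hypothesis s_inv : s ^ tau x = s^-1.
Hypothesis n_gt0 : (0 < n)%N.
Hypothesis periodE :
  forall i j, axact x (s ^+ i) = axact x (s ^+ j) <-> i = j %[mod n].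
Hypothesis cover : forall v, v <> a -> exists i, v = axact x (s ^+ i).

(** Stated for exponents modulo n and without subtraction: m stands for
    2i - j, so that this is the formula of the reflection tau_i of the n-gon. *)
Lemma rotation_tau i j m : m + j = i + i %[mod n] ->
  axact (axact x (s ^+ j)) (tau (axact x (s ^+ i))) = axact x (s ^+ m).
Proof.
move=> mj; apply: (@axact_inj _ _ (s ^+ j)).
rewrite -[RHS]axactM -expgnDr (iffRL (periodE _ _) mj) tauJ conjgE -!axactM.
(* tau_x may be moved to the left, inverting s, until it meets x. *)
have flip : axact x (s ^+ j * s ^- i * tau x) = axact x (s ^- j * s ^+ i).
  rewrite conjgC conjMg conjVg !conjXg s_inv !expVgn invgK.
  by rewrite axactM tau_stab.
rewrite !mulgA -[_ * tau x * _ * _]mulgA axactM flip -axactM -!expgnDr.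
by rewrite -mulgA -expgnDr addnA addnC expgnDr mulKg.
Qed.

Definition polygon_axis (u : option (Zmod n)) : X :=
  if u is Some i then axact x (s ^+ i) else a.

Lemma rotated_axis_neq (i : nat) : axact x (s ^+ i) <> a.
Proof.
move=> E; apply: xa; apply: (@axact_inj _ _ (s ^+ i)); rewrite E.
by elim: i {E} => [|i IH]; rewrite ?axact1 // expgS axactM fix_as.
Qed.

Lemma polygon_axis_bij : bijective polygon_axis.
Proof.
have nE : n.-1.+1 = n by rewrite prednK.
suff [f fK] : exists f, cancel f polygon_axis.
  exists f => // u; have := fK (polygon_axis u).
  case: (f _) => [i|] /=; case: u => [j|] //=.
  - move/(iffLR (periodE _ _)); rewrite !modn_small -?[X in (_ < X)%N]nE //.
    by move=> ij; congr Some; apply: val_inj.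
  - by move/rotated_axis_neq.
  - by move/esym/rotated_axis_neq.
suff sur v : exists u, polygon_axis u = v.
  by exists (fun v => sval (cid (sur v))) => v; case: (cid (sur v)).
have [->|/cover[i ->]] := pselect (v = a); first by exists None.
exists (Some (inZp i)); apply/periodE; rewrite /= nE; exact: modn_mod.
Qed.

(** An axis x and a symmetry s inverted by tau_x determine the whole structure:
    the value of tau at x s^i is the conjugate of tau_x by s^i, so only the
    action of tau_a, which is read off at x, remains to be compared. *)
Lemma recognize_fix_axet (z : dihedral n) (z2 : z * z = 1)
    (zC : forall g, commute z g) (r : Zmod n) :
  z = rotation r -> axact x (tau a) = axact x (s ^+ r) ->
  commute s (tau a) -> axet_iso X (fix_axet z2 zC).
Proof.
move=> zE ax sa; have nE : n.-1.+1 = n by rewrite prednK.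
have [psi phiK psiK] := polygon_axis_bij.
exists psi; split; last by exists polygon_axis.
have phi_tau w u : polygon_axis (dih_act_fix u (tau_fix z w)) =
    axact (polygon_axis u) (tau (polygon_axis w)).
  case: u => [j|] /=; last by rewrite fix_a.
  case: w => [i|] /=; apply/esym; first exact/rotation_tau/Zmod_reflection.
  rewrite -axactM (commute_sym (commuteX _ (commute_sym sa))) axactM ax.
  by rewrite -axactM -expgnDr zE; apply/periodE/esym/Zmod_rotation.
move=> v w e; rewrite -[in LHS](psiK v) -[in LHS](psiK w).
have [->|->] := Z2_cases e; first by rewrite !axtau0 !axact1 psiK.
by rewrite -phi_tau phiK.
Qed.

End Recognition.

(** * The axes other than the fixed one form a cycle *)

Section Cycle.
Variables (X : axet 'Z_2) (a x y : X).
Hypothesis orbitsE : miy_orbits X = [set [set a]; ~` [set a]].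
Hypothesis gen : axet_span [set a; x; y] = setT.
Hypotheses (xa : x <> a) (ya : y <> a).

Let rho := tau x * tau y.

Lemma tau_fixed v : axact a (tau v) = a.
Proof. by apply: (two_orbits_fixed _ _ _ orbitsE); apply: axtau_miy. Qed.

Lemma tau_fixed_commute v : commute (tau a) (tau v).
Proof. by rewrite /commute conjgC -tauJ tau_fixed. Qed.

Lemma commute_rho_tau : commute rho (tau a).
Proof. by apply/commute_sym/commuteM; apply: tau_fixed_commute. Qed.

Lemma rho_inverted : rho ^ tau x = rho^-1.
Proof. by rewrite /rho conjgE invgM !tauV !mulgA tau_sq mul1g. Qed.

(** The exponents i and -j separately, with natural i and j, encode an integer
    power of rho. *)
Definition translates : set X :=
  [set v | exists i j e : nat, v = axact x (rho ^+ i * rho ^- j * tau a ^+ e)].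

Lemma translation_tau_x i j e :
  (rho ^+ i * rho ^- j * tau a ^+ e) ^ tau x = rho ^+ j * rho ^- i * tau a ^+ e.
Proof.
rewrite !conjMg conjVg !conjXg rho_inverted -tauJ tau_fixed !expVgn invgK.
by rewrite (commuteV (commuteX2 j i (commute_refl rho))).
Qed.

Lemma translation_rho i j e : commute rho (rho ^+ i * rho ^- j * tau a ^+ e).
Proof.
apply: commuteM; last exact: commuteX commute_rho_tau.
by apply: commuteM; last apply: commuteV; apply: commuteX.
Qed.

Lemma translates_tau_x v : translates v -> translates (axact v (tau x)).
Proof.
case=> i [j [e ->]]; exists j, i, e.
by rewrite -axactM conjgC translation_tau_x axactM tau_stab.
Qed.

Lemma translates_rho v : translates v -> translates (axact v rho).
Proof.
case=> i [j [e ->]]; exists i.+1, j, e; rewrite -axactM; congr axact.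
by rewrite -translation_rho expgS !mulgA.
Qed.

Lemma translates_tau_y v : translates v -> translates (axact v (tau y)).
Proof.
have -> : tau y = tau x * rho by rewrite mulgA tau_sq mul1g.
by rewrite axactM => /translates_tau_x/translates_rho.
Qed.

Lemma translates_tau_a v : translates v -> translates (axact v (tau a)).
Proof.
by case=> i [j [e ->]]; exists i, j, e.+1; rewrite -axactM expgSr mulgA.
Qed.

(** The elements of the group that preserve [translates] in both directions
    form a subgroup, so only the generators of X matter. *)
Lemma translates_miy g v : miy X g -> translates v <-> translates (axact v g).
Proof.
move=> Mg; move: g Mg v.
pose K := [set g | forall v, translates v <-> translates (axact v g)].
apply: (miy_sub_subgroup _ _ _ K gen).
  split=> [v|g h Hg Hh v|g Hg v]; first by rewrite axact1.
    by rewrite axactM; apply: iff_trans (Hg v) (Hh _).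
  by have := Hg (axact v g^-1); rewrite -axactM mulVg axact1; apply: iff_sym.
have inv w : (forall v, translates v -> translates (axact v (tau w))) ->
    forall v, translates v <-> translates (axact v (tau w)).
  by move=> H v; split=> [/H|/H] //; rewrite -axactM tau_sq axact1.
move=> w e Yw v; have [->|->] := Z2_cases e; first by rewrite axtau0 axact1.
apply: inv => {}v.
case: Yw => [[->|->]|->]; first exact: translates_tau_a.
  exact: translates_tau_x.
exact: translates_tau_y.
Qed.

Lemma translatesE v : v <> a -> translates v.
Proof.
move=> va; have [g Mg ->] := two_orbits_transitive _ _ _ orbitsE _ _ xa va.
apply/(translates_miy g x Mg).
by exists 0%N, 0%N, 0%N; rewrite !expg0 invg1 !mulg1 axact1.
Qed.

(** Transitivity makes tau_y = tau_x rho a conjugate of tau_x by some h that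
    tau_x inverts up to powers of tau_a; such a conjugate is tau_x rho^(2k) for
    some integer k, so comparing the two gives an odd power of rho. *)
Lemma rho_odd_order : exists2 c, odd c & rho ^+ c = 1.
Proof.
have [i [j [e yE]]] := translatesE _ ya.
have rij : rho ^+ j.*2.+1 = rho ^+ i.*2.
  have := translation_tau_x i j e; have := translation_rho i j e.
  set h := (rho ^+ i * _ * _) => rh hx.
  have : h * tau x * rho = h * tau y.
    by rewrite -mulgA; congr (_ * _); rewrite mulgA tau_sq mul1g.
  rewrite [in RHS]yE tauJ -conjgC (conjgC h) hx -mulgA => /mulgI.
  rewrite /h -(mulgA _ _ rho) -(commuteX _ commute_rho_tau) mulgA => /mulIg.
  rewrite (commuteV (commuteX2 j i (commute_refl rho))) -mulgA => /esym E.
  have {}E : rho ^+ i.*2 * rho ^- j = rho ^+ j.+1.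
    by rewrite -addnn expgnDr -mulgA E mulKVg expgSr.
  by rewrite -addnn -addSn expgnDr -E mulgKV.
have [ij|ij] := ltnP i.*2 j.*2.+1.
  exists (j.*2.+1 - i.*2); first by rewrite oddB 1?ltnW //= !odd_double.
  apply: (@mulgI _ (rho ^+ i.*2)).
  by rewrite -expgnDr subnKC 1?ltnW // rij mulg1.
exists (i.*2 - j.*2.+1); first by rewrite oddB //= !odd_double.
by apply: (@mulgI _ (rho ^+ j.*2.+1)); rewrite -expgnDr subnKC // rij mulg1.
Qed.

Let sigma := rho * tau a.

Lemma sigma_inverted : sigma ^ tau x = sigma^-1.
Proof.
rewrite /sigma conjMg rho_inverted -tauJ tau_fixed (invgM rho (tau a)) tauV.
exact: (esym (commuteV (commute_sym commute_rho_tau))).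
Qed.

(** The cyclic groups generated by rho and tau_a have coprime orders, hence
    their product is cyclic. *)
Lemma cycle_generator c : odd c -> rho ^+ c = 1 ->
  tau a = sigma ^+ c /\ rho = sigma ^+ c.+1.
Proof.
move=> oc rc.
have ta k : tau a ^+ k = tau a ^+ odd k.
  rewrite -[in LHS](odd_double_half k) expgnDr -mul2n expgnA expg2 tau_sq.
  by rewrite expg1n mulg1.
have sX k : sigma ^+ k = rho ^+ k * tau a ^+ k.
  by apply: expgMn; apply: commute_rho_tau.
by rewrite !sX (ta c) (ta c.+1) /= oc (expgSr rho c) rc /= expg1 !mul1g mulg1.
Qed.

Lemma cycle_cover c v : odd c -> rho ^+ c = 1 -> v <> a ->
  exists k, v = axact x (sigma ^+ k).
Proof.
move=> oc rc /translatesE[i [j [e ->]]].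
have [aE rE] := cycle_generator _ oc rc.
have -> : rho ^- j = rho ^+ (j * c.-1).
  apply: (@mulgI _ (rho ^+ j)); rewrite mulgV -expgnDr -mulnS.
  by rewrite prednK ?odd_gt0 // mulnC expgnA rc expg1n.
rewrite [in rho ^+ i]rE [in X in _ * X * _]rE aE -!expgnA -!expgnDr.
by eexists.
Qed.

End Cycle.

(** * Classification *)

Lemma three_generated_fixed (X : axet 'Z_2) (a : X) :
  three_generated X -> miy_orbits X = [set [set a]; ~` [set a]] ->
  exists x y : X,
    [/\ x <> a, y <> a, x <> y & axet_span [set a; x; y] = setT].
Proof.
case=> p [q [w [pq pw qw gen]]] orbitsE.
have fix_a v e : axact a (axtau v e) = a.
  by apply: (two_orbits_fixed _ _ _ orbitsE); apply: axtau_miy.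
case: (fixed_axis_generator _ _ _ _ gen fix_a) => [[|]|] /= ->.
- by exists q, w; split=> // /esym.
- by exists p, w; split=> //; [move=> /esym|rewrite [[set q] `|` _]setUC].
- by exists p, q; split=> //; rewrite -setUA setUC.
Qed.

Theorem proposition1p3 (X : axet 'Z_2) (a : X) :
  three_generated X ->
  miy_orbits X = [set [set a]; ~` [set a]] ->
  (exists n : nat, [/\ (3 <= n)%N, odd n & axet_iso X (X1 n)]) \/
  (exists k : nat, odd k /\ axet_iso X (X2 k)).
Proof.
move=> gen3 orbitsE.
have [x [y [xa ya xy gen]]] := three_generated_fixed _ _ gen3 orbitsE.
have fix_a := tau_fixed _ _ orbitsE.
have [c oc rc] := rho_odd_order _ _ _ _ orbitsE gen xa ya.
have [aE _] := cycle_generator _ _ x y orbitsE _ oc rc.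
have cover v := cycle_cover _ _ _ _ orbitsE gen xa c v oc rc.
have sx := sigma_inverted _ _ x y orbitsE.
set sigma := tau x * tau y * tau a in aE cover sx.
have fix_asigma : axact a sigma = a by rewrite !axactM !fix_a.
have sigma_a : commute sigma (tau a) by rewrite aE; apply: commuteX.
have sigma2c : axact x (sigma ^+ c.*2) = x.
  by rewrite -addnn expgnDr -aE tau_sq axact1.
have [|n n0 periodE] := axact_period _ _ _ _ _ _ sigma2c.
  by rewrite double_gt0 odd_gt0.
have n2c : (n %| c.*2)%N.
  by rewrite /dvdn -(mod0n n); apply/eqP/periodE; rewrite sigma2c expg0 axact1.
have recognize :=
  recognize_fix_axet _ _ _ _ _ fix_a xa fix_asigma sx n0 periodE cover.
have [odd_n|even_n] := boolP (odd n); [left; exists n|right; exists n./2].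
  split=> //.
    (* If n = 1, the axis x is the only one besides a, contradicting x <> y. *)
    case: n n0 periodE odd_n {n2c recognize} => [|[|[|n]]] // _ periodE _.
    have [i yE] := cover _ ya; case: xy; rewrite yE -[LHS]axact1 -(expg0 sigma).
    by apply/periodE; rewrite !modn1.
  apply: (recognize _ _ _ 0%R) => //; rewrite {1}aE.
  (* n is odd and divides 2c, so it divides c. *)
  apply/periodE/eqP; rewrite mod0n -/(dvdn _ _) -(@Gauss_dvdr _ 2) ?mul2n //.
  by rewrite coprimen2.
set k := n./2.
have nE : n = k.*2 by rewrite -[LHS]odd_double_half (negPf even_n).
move: n0 n2c periodE recognize; rewrite nE => n0 n2c periodE recognize.
have kc : (k %| c)%N by move: n2c; rewrite -!mul2n dvdn_pmul2l.
split; first exact: dvdn_odd kc oc.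
apply: (recognize _ _ _ (inZp k)) => //; rewrite {1}aE; apply/periodE.
rewrite /= prednK // modn_mod.
(* c = qk with q odd, so c is k modulo 2k. *)
case/dvdnP: kc oc => q ->; rewrite oddM => /andP[oq _].
rewrite -(odd_double_half q) oq mulnDl mul1n -doubleMl doubleMr addnC.
by rewrite modnMDl.
Qed.
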